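(* Let $k$ be a field. Then, for every integer $l\ge 0$ (and $l\geq 1$ in (iii)): (i) a word $w\in F_k^l$ lies in $\mathcal A^l$ if and only if $\alpha w\in\mathcal C^{l+1}$ and $w\alpha\in \mathcal C^{l+1}$ for every $\alpha\in k$; (ii) for every $w\in\mathcal C^l$ there exist unique $\alpha,\beta\in k$ such that $\alpha w\in\mathcal A^{l+1}$ and $w\beta\in\mathcal A^{l+1}$; (iii) if $\alpha_1\cdots\alpha_l\in\mathcal A^l$, then $\alpha_2\alpha_3\cdots\alpha_l\in\mathcal C^{l-1}$ and $\alpha_1\alpha_2\cdots\alpha_{l-1}\in\mathcal C^{l-1}$; (iv) $\alpha_1\alpha_2\cdots\alpha_{l-1}\alpha_l\in\mathcal A^l$ if and only if $\alpha_l\alpha_{l-1}\cdots\alpha_2\alpha_1\in\mathcal A^l$; (v) $\alpha_1\cdots\alpha_l\in\mathcal A^l$ if and only if $(-\alpha_1)\cdots(-\alpha_l)\in\mathcal A^l$.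
   Context: For a field $k$, let $F_k$ be the free monoid of all finite words $\alpha_1\cdots\alpha_l$ ($l\ge0$) with letters $\alpha_i\in k$ (the empty word $\epsilon$ has length $0$), with concatenation as product, and let $F_k^l$ be the set of words of length exactly $l$. For $\alpha\in k$ put $M_\alpha=\begin{pmatrix}0&-1\\1&\alpha\end{pmatrix}\in\mathrm{SL}_2(k)$, and let $\pi:F_k\to\mathrm{SL}_2(k)$ be the monoid homomorphism $\pi(\alpha_1\cdots\alpha_l)=M_{\alpha_1}\cdots M_{\alpha_l}$ (with $\pi(\epsilon)$ the identity). Let $\mathcal A\subset F_k$ be the set of words $w$ such that $\pi(w)$ maps the line $k\binom{0}{1}$ onto the line $k\binom{1}{0}$; equivalently, $\pi(w)$ has lower-right entry $0$, i.e. $\pi(w)=\begin{pmatrix}a&-b\\ b^{-1}&0\end{pmatrix}$ with $a\in k,\ b\in k^*$. Let $\mathcal C=F_k\setminus\mathcal A$, $\mathcal A^l=\mathcal A\cap F_k^l$, $\mathcal C^l=\mathcal C\cap F_k^l$. *)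

(* Defs.v *)
From HB Require Import structures.
From mathcomp Require Import all_boot all_order all_algebra.

Set Implicit Arguments.
Unset Strict Implicit.
Unset Printing Implicit Defensive.

Import GRing.Theory.
Local Open Scope ring_scope.

(* The free monoid F_k is [seq k]: the product is [++], the empty word [::]. *)

Definition words (k : fieldType) (l : nat) : {pred seq k} :=
  [pred w | size w == l].
Arguments words : clear implicits.

(* M_a = (0 -1; 1 a), listed by rows. *)
Definition letter_mx (k : fieldType) (a : k) : 'M[k]_2 :=
  \matrix_(i < 2, j < 2) (nth [::] [:: [:: 0; -1]; [:: 1; a]] i)`_j.

(* The values have determinant 1; they are kept as plain 2 x 2 matrices since
   MathComp has no special linear group over an infinite field. *)
Definition word_mx (k : fieldType) (w : seq k) : 'M[k]_2 :=
  \prod_(a <- w) letter_mx a.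

Definition axis (k : fieldType) (i : 'I_2) : {vspace 'cV[k]_2} :=
  <[(delta_mx i 0)%R]>%VS.

(* Matrices act on column vectors: [axis k 1] is the line k(0 1)^T and
   [axis k 0] is the line k(1 0)^T. *)
Definition Aset (k : fieldType) : {pred seq k} :=
  [pred w | (linfun (mulmx (word_mx w)) @: axis k 1)%VS == axis k 0].
Arguments Aset : clear implicits.

Definition Cset (k : fieldType) : {pred seq k} := [predC Aset k].
Arguments Cset : clear implicits.

Definition Awords (k : fieldType) (l : nat) : {pred seq k} :=
  [predI Aset k & words k l].
Arguments Awords : clear implicits.

Definition Cwords (k : fieldType) (l : nat) : {pred seq k} :=
  [predI Cset k & words k l].
Arguments Cwords : clear implicits.

(* Main.v *)
(* For [M = word_mx w = (p q; r s)], which has determinant 1, the word [w] is in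
   [Aset] iff [s = 0]. The lower-right entries of [letter_mx a * M] and of
   [M * letter_mx a] are [q + a s] and [a s - r]: they are affine in [a] with
   slope [s], and when [s = 0] the constants [q] and [- r] are nonzero because
   [- q r = 1]. With [D = diag(1, -1)], reversing a word conjugates the
   transpose of [M] by [D], and negating its letters conjugates [M] by [D] up
   to sign; neither affects whether [s = 0]. *)
Require Import Defs.
From HB Require Import structures.
From mathcomp Require Import all_boot all_order all_algebra.
From mathcomp Require Import ring.

Import GRing.Theory.
Local Open Scope ring_scope.

Lemma mulmx2E (R : pzSemiRingType) (m n : nat) (A : 'M[R]_(m, 2)) (B : 'M[R]_(2, n)) i j :
  (A *m B) i j = A i 0 * B 0 j + A i 1 * B 1 j.
Proof.
rewrite mxE !big_ord_recl big_ord0 addr0.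
by congr (_ * _ + A i _ * B _ j); apply: val_inj.
Qed.

(** Case analysis that leaves the literal indices [0] and [1], the form in which [letter_mxE] can
    rewrite. *)
Lemma ord2P (P : 'I_2 -> Prop) : P 0 -> P 1 -> forall i, P i.
Proof.
move=> P0 P1 [[|[|//]] lti].
- by rewrite (_ : Ordinal lti = 0) //; apply: val_inj.
- by rewrite (_ : Ordinal lti = 1) //; apply: val_inj.
Qed.

Section WordMatrices.

Variable k : fieldType.
Implicit Types (a : k) (w : seq k) (i j : 'I_2).

Lemma letter_mxE a :
  (letter_mx a 0 0 = 0) * (letter_mx a 0 1 = -1) *
  (letter_mx a 1 0 = 1) * (letter_mx a 1 1 = a).
Proof. by rewrite !mxE. Qed.

Lemma word_mx_nil : word_mx [::] = 1%:M :> 'M[k]_2.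
Proof. by rewrite /word_mx big_nil. Qed.

Lemma word_mx_cons a w : word_mx (a :: w) = letter_mx a *m word_mx w.
Proof. by rewrite /word_mx big_cons. Qed.

Lemma word_mx_rcons w a : word_mx (rcons w a) = word_mx w *m letter_mx a.
Proof. by rewrite /word_mx -cats1 big_cat big_seq1. Qed.

Lemma word_mx_cons11 a w :
  word_mx (a :: w) 1 1 = word_mx w 0 1 + a * word_mx w 1 1.
Proof. by rewrite word_mx_cons mulmx2E !letter_mxE mul1r. Qed.

Lemma word_mx_rcons11 w a :
  word_mx (rcons w a) 1 1 = a * word_mx w 1 1 - word_mx w 1 0.
Proof. by rewrite word_mx_rcons mulmx2E !letter_mxE; ring. Qed.

Lemma det_word_mx w :
  word_mx w 0 0 * word_mx w 1 1 - word_mx w 0 1 * word_mx w 1 0 = 1.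
Proof.
elim: w => [|a w IHw]; first by rewrite word_mx_nil !mxE /= mulr0 subr0 mulr1.
(* Replacing the right-hand [1] by the determinant of [word_mx w] turns the goal into a polynomial
   identity. *)
by rewrite word_mx_cons !mulmx2E !letter_mxE -[RHS]IHw; ring.
Qed.

Lemma word_mx01_neq0 w : word_mx w 1 1 = 0 -> word_mx w 0 1 != 0.
Proof.
move=> s0; apply: contra_eq_neq (det_word_mx w) => ->.
by rewrite s0 mulr0 mul0r subr0 eq_sym oner_neq0.
Qed.

Lemma word_mx10_neq0 w : word_mx w 1 1 = 0 -> word_mx w 1 0 != 0.
Proof.
move=> s0; apply: contra_eq_neq (det_word_mx w) => ->.
by rewrite s0 !mulr0 subr0 eq_sym oner_neq0.
Qed.

(** Transposition reverses products, and [D *m (letter_mx a)^T *m D = letter_mx a] for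
    [D = diag(1, -1)]; conjugation by [D] multiplies entry [(i, j)] by [(-1) ^+ (i + j)]. *)
Lemma word_mx_rev w i j :
  word_mx (rev w) i j = (-1) ^+ (i + j) * word_mx w j i.
Proof.
elim: w i j => [|a w IHw] i j.
  rewrite word_mx_nil !mxE eq_sym; case: eqVneq => [->|_]; last by rewrite mulr0.
  by rewrite addnn -signr_odd odd_double mul1r.
rewrite rev_cons word_mx_rcons word_mx_cons !mulmx2E !IHw.
by elim/ord2P: i; elim/ord2P: j; rewrite !letter_mxE /=; ring.
Qed.

(** Since [letter_mx (- a) = - (D *m letter_mx a *m D)], each letter contributes one sign, whence
    [size w] in the exponent; [i + j] comes from the conjugation. *)
Lemma word_mx_opp w i j :
  word_mx [seq - a | a <- w] i j = (-1) ^+ (size w + i + j) * word_mx w i j.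
Proof.
elim: w i j => [|a w IHw] i j.
  rewrite word_mx_nil !mxE; case: eqVneq => [->|_]; last by rewrite mulr0.
  by rewrite addnn -signr_odd odd_double mul1r.
rewrite /= !word_mx_cons !mulmx2E !IHw.
by elim/ord2P: i; elim/ord2P: j; rewrite !letter_mxE /= ?(addn0, addn1) !exprS; ring.
Qed.

(** The image of the line [axis k 1] is spanned by the second column [v] of [word_mx w], so only the
    lower entry of [v] has to vanish; the determinant keeps [v] nonzero. *)
Lemma AsetE w : (w \in Aset k) = (word_mx w 1 1 == 0).
Proof.
rewrite inE /axis limg_line lfunE /=.
have vE i : (word_mx w *m delta_mx 1 0 : 'cV_2) i 0 = word_mx w i 1.
  by rewrite mulmx2E !mxE /= mulr0 add0r mulr1.
set v := _ *m _ in vE *; apply/eqP/eqP => [eq_line | s0].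
  have /vlineP[c vc] : v \in <[(delta_mx 0 0 : 'cV[k]_2)%R]>%VS.
    by rewrite -eq_line memv_line.
  by rewrite -vE vc !mxE /= mulr0.
have q_neq0 := word_mx01_neq0 w s0.
have vq : v = word_mx w 0 1 *: delta_mx 0 0.
  apply/matrixP => i j; rewrite (ord1 j) vE.
  by elim/ord2P: i; rewrite !mxE /= ?mulr1 ?mulr0.
(* Both inclusions of lines: [v] is a multiple of the basis vector, and the reverse one divides by
   the nonzero upper entry of [v]. *)
apply: subv_anti; rewrite -!memvE vq memvZ ?memv_line //=.
by apply/vlineP; exists (word_mx w 0 1)^-1; rewrite scalerA mulVf // scale1r.
Qed.

Lemma cons_AsetE a w :
  (a :: w \in Aset k) = (word_mx w 0 1 + a * word_mx w 1 1 == 0).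
Proof. by rewrite AsetE word_mx_cons11. Qed.

Lemma rcons_AsetE w a :
  (rcons w a \in Aset k) = (a * word_mx w 1 1 - word_mx w 1 0 == 0).
Proof. by rewrite AsetE word_mx_rcons11. Qed.

Lemma cons_Aset_notin a w : w \in Aset k -> a :: w \notin Aset k.
Proof.
by rewrite cons_AsetE AsetE => /eqP s0; rewrite s0 mulr0 addr0 word_mx01_neq0.
Qed.

Lemma rcons_Aset_notin w a : w \in Aset k -> rcons w a \notin Aset k.
Proof.
rewrite rcons_AsetE AsetE => /eqP s0.
by rewrite s0 mulr0 sub0r oppr_eq0 word_mx10_neq0.
Qed.

Lemma cons_Aset_unique w :
  w \notin Aset k -> exists! a, a :: w \in Aset k.
Proof.
(* The witness is the root of [q + a * s], whose slope [s] is nonzero because [w] lies outside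
   [Aset k]. *)
rewrite AsetE => s_neq0; exists (- word_mx w 0 1 / word_mx w 1 1); split.
  by rewrite cons_AsetE divfK // subrr.
move=> a; rewrite cons_AsetE addrC addr_eq0 => /eqP <-.
by rewrite mulfK.
Qed.

Lemma rcons_Aset_unique w :
  w \notin Aset k -> exists! a, rcons w a \in Aset k.
Proof.
(* Here the affine function is [a * s - r], with root [r / s]. *)
rewrite AsetE => s_neq0; exists (word_mx w 1 0 / word_mx w 1 1); split.
  by rewrite rcons_AsetE divfK // subrr.
move=> a; rewrite rcons_AsetE subr_eq0 => /eqP <-.
by rewrite mulfK.
Qed.

Lemma rev_Aset w : (rev w \in Aset k) = (w \in Aset k).
Proof. by rewrite !AsetE word_mx_rev mulf_eq0 signr_eq0. Qed.

Lemma opp_Aset w : ([seq - a | a <- w] \in Aset k) = (w \in Aset k).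
Proof. by rewrite !AsetE word_mx_opp mulf_eq0 signr_eq0. Qed.

Lemma in_Awords l w : (w \in Awords k l) = (w \in Aset k) && (size w == l).
Proof. by []. Qed.

Lemma in_Cwords l w : (w \in Cwords k l) = (w \notin Aset k) && (size w == l).
Proof. by []. Qed.

End WordMatrices.

Theorem theorem2p2 (k : fieldType) (l : nat) :
  [/\ forall w : seq k, w \in words k l ->
        (w \in Awords k l <->
         forall a : k, a :: w \in Cwords k l.+1 /\ rcons w a \in Cwords k l.+1),
      forall w : seq k, w \in Cwords k l ->
        (exists! a : k, a :: w \in Awords k l.+1) /\
        (exists! b : k, rcons w b \in Awords k l.+1),
      (1 <= l)%N -> forall w : seq k, w \in Awords k l ->
        behead w \in Cwords k l.-1 /\ take l.-1 w \in Cwords k l.-1,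
      forall w : seq k, w \in words k l ->
        (w \in Awords k l <-> rev w \in Awords k l)
    & forall w : seq k, w \in words k l ->
        (w \in Awords k l <-> [seq - a | a <- w] \in Awords k l)].
Proof.
split=> [w sz_w|w|l_gt0 w|w sz_w|w sz_w].
- rewrite in_Awords (sz_w : size w == l) andbT; split=> [wA a | wC].
    by rewrite !in_Cwords size_rcons /= eqSS (sz_w : size w == l)
      cons_Aset_notin ?rcons_Aset_notin.
  (* Were [w] outside [Aset k], some letter [a] would put [a :: w] into [Aset k], against [wC]. *)
  apply: contraT => /cons_Aset_unique[a [awA _]].
  by have [] := wC a; rewrite in_Cwords awA.
- rewrite in_Cwords => /andP[wC /eqP sz_w]; split.
    have [a [awA a_uniq]] := cons_Aset_unique _ _ wC.
    exists a; split=> [|b]; first by rewrite in_Awords awA /= sz_w eqxx.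
    by rewrite in_Awords => /andP[/a_uniq].
  have [a [waA a_uniq]] := rcons_Aset_unique _ _ wC.
  exists a; split=> [|b]; first by rewrite in_Awords waA size_rcons sz_w eqxx.
  by rewrite in_Awords => /andP[/a_uniq].
- rewrite in_Awords => /andP[wA /eqP sz_w]; rewrite !in_Cwords; split.
    rewrite size_behead sz_w eqxx andbT.
    case: w wA sz_w => [|a w] wA sz_w; first by rewrite -sz_w in l_gt0.
    (* Contrapositive of the forward half of (i): a tail in [Aset k] would expel the whole word. *)
    by apply: contraL wA; apply: cons_Aset_notin.
  rewrite size_takel ?sz_w ?leq_pred // eqxx andbT.
  case/lastP: w wA sz_w => [|w a] wA sz_w; first by rewrite -sz_w in l_gt0.
  (* With [l] rewritten as the length of [rcons w a], the prefix of length [l.-1] is exactly [w]. *)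
  rewrite -sz_w size_rcons /= -cats1 take_size_cat //.
  by apply: contraL wA; apply: rcons_Aset_notin.
- by rewrite !in_Awords rev_Aset size_rev.
- by rewrite !in_Awords opp_Aset size_map.
Qed.
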